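(* Let $M$ be a proper $G$-manifold, $m\in M$, and let $V$ be a slice for the action through $m$ with corresponding $G_m$-equivariant embedding $j\colon V\to M$. Let $X$ be a $G_m$-equivariant vector field on the slice $V$ and let $E(X)$ be its equivariant extension to the tube $G\cdot V$, i.e. $E(X)(g\cdot j(v))=\mathrm d(g_M\circ j)\,X(v)$. If a point $v\in V$ is a $G_m$-stable $G_m$-relative equilibrium of the vector field $X$, then the point $j(v)$ is a $G$-stable $G$-relative equilibrium of the vector field $E(X)$ on the tube $G\cdot V$.
   Context: All manifolds are smooth and Hausdorff. $G$ is a Lie group; $G_m$ is the stabilizer of $m$. A proper $G$-manifold is a manifold with a smooth proper action of $G$. Write $g_M(m)=g\cdot m$. A vector field $X$ on a $G$-manifold $M$ is $G$-equivariant if $X\circ g_M=\mathrm dg_M\circ X$ for all $g\in G$. A point $p$ is a $G$-relative equilibrium of a $G$-equivariant vector field $X$ if $X(p)\in T_p(G\cdot p)$; it is $G$-stable if for every $G$-invariant neighborhood $U$ of $p$ there is a neighborhood $O\subseteq U$ of $p$ such that all maximal integral curves of $X$ starting at points of $O$ stay in $U$ for all times for which they are defined. (The same definitions with $G_m$ and the $G_m$-manifold $V$ in place of $G$ and $M$ give $G_m$-relative equilibria and $G_m$-stability on $V$.) Slice: a slice through $m$ is a $G_m$-manifold $V$ with a $G_m$-equivariant embedding $j\colon V\to M$ such that $m\in j(V)$, the saturation $G\cdot j(V)=\{g\cdot j(v)\}$ (written $G\cdot V$ and called the tube) is open in $M$, and $(g,v)\mapsto g\cdot j(v)$ descends to a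 $G$-equivariant diffeomorphism $G\times^{G_m}V\to G\cdot V$. Here $G\times^{G_m}V=(G\times V)/G_m$ for the action $k\cdot(g,v)=(gk^{-1},k\cdot v)$. *)

(* Defs.v *)
From HB Require Import structures.
From mathcomp Require Import all_boot all_order all_algebra.
From mathcomp Require Import all_classical all_reals all_analysis.
Set Implicit Arguments.
Unset Strict Implicit.
Unset Printing Implicit Defensive.
Import Order.TTheory GRing.Theory Num.Theory.
Import numFieldNormedType.Exports.
Local Open Scope classical_set_scope.
Local Open Scope ring_scope.

(** Manifolds are charted spaces with a smooth atlas, of constant finite
    dimension, without boundary, Hausdorff, not assumed second countable. *)

Fixpoint Ck (R : realType) (n m : nat) (k : nat) (U : set 'rV[R]_n)
    (f : 'rV[R]_n -> 'rV[R]_m) : Prop :=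
  if k is k'.+1 then
    (forall x, U x -> differentiable f x) /\
    (forall u : 'rV[R]_n, Ck k' U (fun x => 'd f x u))
  else forall x, U x -> {for x, continuous f}.

(* Meant for open U: differentiability and continuity are those of f as a
   function on the whole space. *)
Definition Cinfty (R : realType) (n m : nat) (U : set 'rV[R]_n)
    (f : 'rV[R]_n -> 'rV[R]_m) : Prop :=
  forall k, Ck k U f.

(* The values of [chart_fun] off [chart_dom], and of [chart_inv] off
   [chart_img], are irrelevant. *)
Record chart (R : realType) (T : topologicalType) (n : nat) := Chart {
  chart_dom : set T;
  chart_fun : T -> 'rV[R]_n;
  chart_inv : 'rV[R]_n -> T
}.

Definition chart_img (R : realType) (T : topologicalType) n
    (phi : chart R T n) : set 'rV[R]_n :=
  chart_fun phi @` chart_dom phi.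

Definition is_chart (R : realType) (T : topologicalType) n
    (phi : chart R T n) : Prop :=
  [/\ open (chart_dom phi),
      open (chart_img phi),
      (forall p, chart_dom phi p -> chart_inv phi (chart_fun phi p) = p),
      (forall p, chart_dom phi p -> {for p, continuous (chart_fun phi)}) &
      (forall x, chart_img phi x -> {for x, continuous (chart_inv phi)})].

Definition charts_compatible (R : realType) (T : topologicalType) n
    (phi psi : chart R T n) : Prop :=
  Cinfty (chart_fun phi @` (chart_dom phi `&` chart_dom psi))
         (chart_fun psi \o chart_inv phi).

(* [chart_at p] is a preferred chart around p, used to write tangent vectors
   at p in coordinates. *)
HB.mixin Record isCharted (R : realType) T of Topological T := {
  mdim : nat;
  atlas : set (chart R T mdim);
  chart_at : T -> chart R T mdim
}.

#[short(type="chartedType")]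
HB.structure Definition Charted (R : realType) :=
  {T of Topological T & isCharted R T}.

Arguments mdim {R} s.
Arguments atlas {R} s.
Arguments chart_at {R s} _.

HB.mixin Record Charted_isManifold (R : realType) T of Charted R T := {
  manifold_hausdorff : hausdorff_space T;
  atlas_chart : forall phi, atlas T phi -> is_chart phi;
  atlas_compatible : forall phi psi, atlas T phi -> atlas T psi ->
    charts_compatible phi psi;
  chart_at_atlas : forall p : T, atlas T (chart_at p);
  chart_at_dom : forall p : T, chart_dom (chart_at p) p
}.

#[short(type="manifoldType")]
HB.structure Definition Manifold (R : realType) :=
  {T of Charted R T & Charted_isManifold R T}.

Definition prod_chart (R : realType) (S T : topologicalType) n m
    (phi : chart R S n) (psi : chart R T m) :
    chart R (S * T)%type (n + m) :=
  Chart (chart_dom phi `*` chart_dom psi)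
        (fun p => row_mx (chart_fun phi p.1) (chart_fun psi p.2))
        (fun x => (chart_inv phi (lsubmx x), chart_inv psi (rsubmx x))).

HB.instance Definition _ (R : realType) (S T : chartedType R) :=
  isCharted.Build R (S * T)%type
    [set prod_chart phi psi | phi in atlas S & psi in atlas T]
    (fun p => prod_chart (chart_at p.1) (chart_at p.2)).

Section SmoothMaps.
Context {R : realType}.
Implicit Types M N : chartedType R.

Definition smooth_on M N (W : set M) (F : M -> N) : Prop :=
  (forall p, W p -> {for p, continuous F}) /\
  (forall phi psi, atlas M phi -> atlas N psi ->
    Cinfty (chart_fun phi @` (chart_dom phi `&` W `&` F @^-1` chart_dom psi))
           (chart_fun psi \o F \o chart_inv phi)).

Definition smooth M N (F : M -> N) : Prop := smooth_on setT F.

(* A tangent vector at p is the row vector of its coordinates in [chart_at p];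
   [tangent_coord phi p u] gives the coordinates of u in the chart phi. *)
Definition tangent_coord M (phi : chart R M (mdim M)) (p : M)
    (u : 'rV[R]_(mdim M)) : 'rV[R]_(mdim M) :=
  'd (chart_fun phi \o chart_inv (chart_at p)) (chart_fun (chart_at p) p) u.

Definition mdiff M N (F : M -> N) (p : M) (u : 'rV[R]_(mdim M)) :
    'rV[R]_(mdim N) :=
  'd (chart_fun (chart_at (F p)) \o F \o chart_inv (chart_at p))
     (chart_fun (chart_at p) p) u.

Definition vector_field M := M -> 'rV[R]_(mdim M).

Definition smooth_vector_field_on M (W : set M) (X : vector_field M) : Prop :=
  forall phi, atlas M phi ->
    Cinfty (chart_fun phi @` (chart_dom phi `&` W))
           (fun x => tangent_coord phi (chart_inv phi x) (X (chart_inv phi x))).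

Definition immersion M N (F : M -> N) : Prop :=
  smooth F /\ forall p, injective (mdiff F p).

Definition submersion M N (F : M -> N) : Prop :=
  smooth F /\ forall p u, exists v, mdiff F p v = u.

(* The second and third conditions say that F is a homeomorphism onto its
   image with the subspace topology. *)
Definition embedding M N (F : M -> N) : Prop :=
  [/\ immersion F,
      injective F &
      forall A : set M, open A -> exists2 B : set N, open B & A = F @^-1` B].

Definition diffeomorphism_onto M N (W : set N) (F : M -> N) : Prop :=
  [/\ open W, range F = W, smooth F &
      exists2 H : N -> M, cancel F H & smooth_on W H].

End SmoothMaps.

Section IntegralCurves.
Context {R : realType}.
Implicit Type M : chartedType R.

(* X is only considered on W, and the curve c only on the interval I. *)
Definition integral_curve M (W : set M) (X : vector_field M)
    (I : set R) (c : R -> M) : Prop :=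
  [/\ open I, is_interval I, I 0 &
      forall t, I t ->
        [/\ W (c t), {for t, continuous c} &
            is_derive t (1 : R) (fun s => chart_fun (chart_at (c t)) (c s))
              (X (c t))]].

Definition maximal_integral_curve M (W : set M) (X : vector_field M)
    (I : set R) (c : R -> M) : Prop :=
  integral_curve W X I c /\
  forall J d, integral_curve W X J d -> I `<=` J ->
    (forall t, I t -> d t = c t) -> J `<=` I.

End IntegralCurves.

HB.mixin Record Manifold_isLieGroup (R : realType) G
    of Manifold R G & Group G := {
  smooth_mulg : smooth (fun x : G * G => (x.1 * x.2)%g);
  smooth_invg : smooth (fun x : G => x^-1%g)
}.

#[short(type="lieGroupType")]
HB.structure Definition LieGroup (R : realType) :=
  {G of Manifold R G & Group G & Manifold_isLieGroup R G}.

Section Actions.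
Context {R : realType}.
Implicit Types (G K : lieGroupType R) (M V : manifoldType R).

Definition smooth_action G M (a : G -> M -> M) : Prop :=
  [/\ forall p, a 1%g p = p,
      forall g h p, a (g * h)%g p = a g (a h p) &
      smooth (fun x : G * M => a x.1 x.2)].

Definition proper_action G M (a : G -> M -> M) : Prop :=
  smooth_action a /\
  forall C : set (M * M), compact C ->
    compact ((fun x : G * M => (a x.1 x.2, x.2)) @^-1` C).

Definition invariant G M (a : G -> M -> M) (U : set M) : Prop :=
  forall g p, U p -> U (a g p).

(* In the next definitions W is an open invariant subset of M, itself a
   G-manifold, with the tangent spaces of M. *)
Definition equivariant_vector_field G M (a : G -> M -> M) (W : set M)
    (X : vector_field M) : Prop :=
  smooth_vector_field_on W X /\
  forall g p, W p -> X (a g p) = mdiff (a g) p (X p).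

(* The tangent space of the orbit, as the image of the tangent space of G at 1
   under the differential of the orbit map. *)
Definition orbit_tangent G M (a : G -> M -> M) (p : M) :
    set 'rV[R]_(mdim M) :=
  range (mdiff (fun g : G => a g p) 1%g).

Definition relative_equilibrium G M (a : G -> M -> M) (W : set M)
    (X : vector_field M) (p : M) : Prop :=
  W p /\ orbit_tangent a p (X p).

Definition stable G M (a : G -> M -> M) (W : set M)
    (X : vector_field M) (p : M) : Prop :=
  forall U : set M, U `<=` W -> nbhs p U -> invariant a U ->
  exists O : set M, [/\ O `<=` U, nbhs p O &
    forall I c, maximal_integral_curve W X I c -> O (c 0) ->
      forall t, I t -> U (c t)].

(* K with the inclusion i is the stabilizer of m, as an embedded Lie
   subgroup of G. *)
Definition is_stabilizer G M (a : G -> M -> M) (m : M) K (i : K -> G) : Prop :=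
  [/\ forall k l, i (k * l)%g = (i k * i l)%g,
      embedding i &
      range i = [set g | a g m = m]].

(* Q with the projection q is the quotient manifold (G x V) / K, for the
   action k . (g, v) = (g k^-1, k . v). *)
Definition is_associated_bundle G K V (i : K -> G) (b : K -> V -> V)
    (Q : manifoldType R) (q : G * V -> Q) : Prop :=
  [/\ forall z, exists x, q x = z,
      forall x y, q x = q y <->
        exists k, y = ((x.1 * (i k)^-1)%g, b k x.2),
      forall A : set Q, open A <-> open (q @^-1` A) &
      submersion q].

Definition tube G M V (a : G -> M -> M) (j : V -> M) : set M :=
  [set p | exists g v, p = a g (j v)].

Definition is_slice G M (a : G -> M -> M) (m : M) K (i : K -> G)
    V (b : K -> V -> V) (j : V -> M) : Prop :=
  [/\ smooth_action b,
      embedding j /\ (forall k v, j (b k v) = a (i k) (j v)),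
      range j m,
      open (tube a j) &
      exists (Q : manifoldType R) (q : G * V -> Q) (Phi : Q -> M),
        [/\ is_associated_bundle i b q,
            forall g v, Phi (q (g, v)) = a g (j v),
            forall h g v, Phi (q ((h * g)%g, v)) = a h (Phi (q (g, v))) &
            diffeomorphism_onto (tube a j) Phi]].

(* Only the values of Y on the tube matter, and there they are determined by
   X. *)
Definition is_equivariant_extension G M V (a : G -> M -> M) (j : V -> M)
    (X : vector_field V) (Y : vector_field M) : Prop :=
  equivariant_vector_field a (tube a j) Y /\
  forall g v, Y (a g (j v)) = mdiff (a g \o j) v (X v).

End Actions.

(* Main.v *)
Require Import Defs.
From HB Require Import structures.
From mathcomp Require Import all_boot all_order all_algebra.
From mathcomp Require Import all_classical all_reals all_analysis.
From mathcomp Require Import lra.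
Set Implicit Arguments.
Unset Strict Implicit.
Unset Printing Implicit Defensive.
Import Order.TTheory GRing.Theory Num.Theory.
Import numFieldNormedType.Exports.
Local Open Scope classical_set_scope.
Local Open Scope ring_scope.

(* An integral curve of E(X) that starts in a translate g.j(V) of the slice stays
   in it: j(V) is closed in the tube, because Gm is closed in G and the tube
   carries the quotient topology of G x V, and E(X) is tangent to j(V), so
   Nagumo's invariance theorem applies to the locally Lipschitz field E(X).
   Hence every maximal integral curve of E(X) has the form g.j(e), where e is an
   integral curve of X because j is an immersion and a homeomorphism onto its
   image; e is maximal because g.j maps any extension of e to an extension of
   the given curve.  Given an invariant U around j(v), stability of v applied to
   j^-1(U) gives a neighborhood O of v, and G.j(O) is the required
   neighborhood of j(v). *)

(** * Derivatives as first-order estimates, a Gronwall inequality, and local Lipschitz bounds in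
    coordinates *)

Section Calculus.
Context {R : realType}.

(** Multiplying the difference quotient by [h] gives a first-order estimate that also holds at
    [h = 0]. The estimates for Nagumo's theorem and for lifting velocities use this form. *)
Lemma is_derive_normP (V : normedModType R) (y : R -> V) (t : R) (u : V) :
  is_derive t 1 y u <->
  forall e, 0 < e -> \forall h \near 0, `|y (t + h) - y t - h *: u| <= e * `|h|.
Proof.
have E (h : R) : h != 0 ->
    h *: (h^-1 *: (y (h *: 1 + t) - y t) - u) = y (t + h) - y t - h *: u.
  by move=> h0; rewrite scalerBr scalerA divff // scale1r [h *: 1]mulr1 (addrC h).
split=> [[/cvg_ex[l yl] yu] e e0|H].
  have {}yu : l = u by rewrite -yu; apply/esym/cvg_lim.
  subst l; move/cvgrPdistC_le/(_ _ e0) : yl => /=.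
  rewrite near_withinE; apply: filterS => h Hh.
  have [->|h0] := eqVneq h 0; first by rewrite addr0 subrr scale0r subrr !normr0 mulr0.
  by rewrite -E // normrZ mulrC ler_wpM2r // Hh.
have yl : (fun h : R => h^-1 *: (y (h *: 1 + t) - y t)) @ 0^' --> u.
  apply/cvgrPdistC_le => e e0; rewrite near_withinE.
  apply: filterS (H e e0) => h Hh h0.
  by rewrite -(@ler_pM2l _ `|h|) ?normr_gt0 // -normrZ E // mulrC.
by split; [apply/cvg_ex; exists u|exact/cvg_lim].
Qed.

Lemma differentiable_norm (V W : normedModType R) (f : V -> W) (x : V) (e : R) :
  differentiable f x -> 0 < e ->
  \forall h \near (0 : V), `|f (h + x) - f x - 'd f x h| <= e * `|h|.
Proof.
move=> /diff_locally df e0; move: df; set k := 'o _ => df.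
have /(littleoP [littleo of k]) := e0.
apply: filterS => h; apply: le_trans.
have -> : f (h + x) = f x + 'd f x h + k h by rewrite -[LHS]/((f \o shift x) h) df.
by rewrite -[X in `|X|]addrA -opprD [_ + k h]addrC addrK.
Qed.

Lemma is_derive_diff_comp (V W : normedModType R) (f : V -> W) (y : R -> V)
    (t : R) (u : V) :
  is_derive t 1 y u -> differentiable f (y t) ->
  is_derive t 1 (f \o y) ('d f (y t) u).
Proof.
move=> [/derivable1_diffP dy yu] df.
have dfy : differentiable (f \o y) t by exact: differentiable_comp.
split; first exact/derivable1_diffP.
by rewrite deriveE // diff_comp //= -(deriveE _ dy) yu.
Qed.

(** The growth condition bounds difference quotients only, because it is meant for a distance
    function, which need not be differentiable. The function [d] is compared with
    [e * expR ((L + 1) * (t - a))], whose rate [L + 1] exceeds [L], and [e] is arbitrary. *)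
Lemma gronwall_right (d : R -> R) (a b L : R) : 0 <= L ->
  (forall t, a <= t < b -> {for t, continuous d}) -> d a <= 0 ->
  (forall t, a <= t < b -> forall e, 0 < e ->
    \forall h \near 0, d (t + h) <= d t + `|h| * (L * d t + e)) ->
  forall t, a <= t < b -> d t <= 0.
Proof.
move=> L0 cd da dh t1 /andP[at1 t1b].
suff zt e : 0 < e -> d t1 <= e * expR ((L + 1) * (t1 - a)).
  rewrite leNgt; apply/negP => dt1.
  (* For this choice of [e] the bound would read [d t1 <= d t1 / 2]. *)
  have e0 : 0 < d t1 / expR ((L + 1) * (t1 - a)) / 2.
    by rewrite divr_gt0 // divr_gt0 // expR_gt0.
  have := zt _ e0; rewrite mulrAC divfK ?gt_eqF ?expR_gt0 //.
  lra.
move=> e0; pose z t := e * expR ((L + 1) * (t - a)).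
have z_gt0 t : 0 < z t by rewrite mulr_gt0 // expR_gt0.
have cz t : {for t, continuous z}.
  apply: cvgM; first exact: cvg_cst.
  apply: (@continuous_comp _ _ _ (fun t => (L + 1) * (t - a)) expR).
    apply: cvgM; first exact: cvg_cst.
    by apply: cvgB; [exact: cvg_id|exact: cvg_cst].
  exact: continuous_expR.
rewrite leNgt; apply/negP => bad1.
pose B := [set t | a <= t <= t1 /\ z t < d t].
have B1 : B t1 by split; rewrite ?at1 ?lexx.
have infB : has_inf B by split; [exists t1|exists a => t [/andP[]]].
(* The first time at which [d] exceeds the strict supersolution [z]. *)
pose T := inf B.
have aT : a <= T by apply: lb_le_inf; [exists t1|move=> t [/andP[]]].
have Tt1 : T <= t1 by apply: ge_inf => //; case: infB.
have Tb : a <= T < b by rewrite aT (le_lt_trans Tt1).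
have good s : a <= s -> s < T -> d s <= z s.
  move=> as_ sT; rewrite leNgt; apply/negP => sbad.
  suff : T <= s by rewrite leNgt sT.
  apply: ge_inf; first by case: infB.
  by split=> //; rewrite as_ (le_trans (ltW sT)).
(* If [d] exceeded [z] at [T], then [T] would differ from [a], where [d] is at most 0, and by
   continuity [d] would exceed [z] already slightly before [T], against [good]. *)
have dT : d T <= z T.
  rewrite leNgt; apply/negP => TB.
  have aT' : a < T.
    rewrite lt_neqAle aT andbT; apply/negP => /eqP aT'.
    by move: TB; rewrite -aT' ltNge (le_trans da) // ltW.
  have : \forall s \near T, z s < d s.
    have dz : (d - z) @ T --> d T - z T by apply: cvgB; [exact: cd|exact: cz].
    have dz0 : 0 < d T - z T by rewrite subr_gt0.
    have := @cvgr_gt _ _ _ (nbhs_filter T) _ _ dz _ dz0.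
    by apply: filterS => s; rewrite /= subr_gt0.
  move=> /nbhs_normP[r /= r0 Hr].
  pose s := Num.max a (T - r / 2).
  have sT : s < T by rewrite gt_max aT' /=; lra.
  have as_ : a <= s by rewrite le_max lexx.
  have sr : T - r / 2 <= s by rewrite le_max lexx orbT.
  have := good _ as_ sT; rewrite leNgt => /negP; apply; apply: Hr => /=.
  by rewrite ger0_norm ?subr_ge0 ?(ltW sT) //; lra.
(* The growth condition at [T] with error [z T] gives, for [s] slightly after [T],
   [d s <= z T * (1 + (L + 1) * (s - T))]. This is at most [z s] because [1 + x <= expR x], so no
   [s] in [B] can be close to [T]. *)
have := dh _ Tb _ (z_gt0 T) => /nbhs_normP[r /= r0 Hr].
have [|s Bs sTr] := @inf_adherent _ B r r0; first by case: infB.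
have [/andP[as_ st1] sbad] := Bs.
have Ts : T <= s by apply: ge_inf => //; case: infB.
have := Hr (s - T); rewrite /= sub0r normrN ger0_norm ?subr_ge0 //.
rewrite ltrBlDl => /(_ sTr); rewrite [T + _]addrC subrK.
apply/negP; rewrite -ltNge; apply: le_lt_trans sbad.
have -> : z s = z T * expR ((L + 1) * (s - T)).
  rewrite /z -mulrA -expRD; congr (_ * expR _); lra.
apply: (@le_trans _ _ (z T * (1 + (L + 1) * (s - T)))); last first.
  by rewrite ler_pM2l // expR_ge1Dx.
have sT0 : 0 <= s - T by rewrite subr_ge0.
have -> : z T * (1 + (L + 1) * (s - T)) = z T + (s - T) * (L * z T + z T) by lra.
by rewrite lerD // ler_wpM2l // lerD2r ler_wpM2l.
Qed.

(** The condition involves only [|h|], so it survives time reversal, and times before [a] reduce to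
    the one-sided case for [d \o -%R]. *)
Lemma gronwall (d : R -> R) (a r L : R) : 0 <= L ->
  (forall t, `|t - a| < r -> {for t, continuous d}) -> d a <= 0 ->
  (forall t, `|t - a| < r -> forall e, 0 < e ->
    \forall h \near 0, d (t + h) <= d t + `|h| * (L * d t + e)) ->
  forall t, `|t - a| < r -> d t <= 0.
Proof.
move=> L0 cd da dh t tr.
have [at_|ta] := leP a t.
  apply: (@gronwall_right d a (a + r) L) => //.
  - by move=> s /andP[? ?]; apply: cd; rewrite ger0_norm ?subr_ge0 // ltrBlDl.
  - by move=> s /andP[? ?]; apply: dh; rewrite ger0_norm ?subr_ge0 // ltrBlDl.
  - by rewrite at_ -ltrBlDl -(@ger0_norm _ (t - a)) ?subr_ge0.
have E s : - a <= s < - a + r -> `|- s - a| < r.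
  by move=> /andP[? ?]; rewrite ltr_norml; apply/andP; split; lra.
rewrite -[t]opprK; apply: (@gronwall_right (d \o -%R) (- a) (- a + r) L) => //=.
- move=> s /E sE; apply: continuous_comp; first exact: opp_continuous.
  exact: cd.
- by rewrite opprK.
- move=> s /E sE e e0; have := dh _ sE _ e0.
  rewrite -{1}[0]oppr0 nearN; apply: filterS => h.
  by rewrite opprD normrN.
- rewrite lerN2 (ltW ta) /=; move: tr; rewrite ltr0_norm ?subr_lt0 //; lra.
Qed.

Lemma coord_le_norm n (x : 'rV[R]_n) j : `|x 0 j| <= `|x|.
Proof.
by rewrite [leRHS]/Num.Def.normr /= mx_normrE; exact: (le_bigmax _ _ (0, j)).
Qed.

Lemma norm_le_coord n (x : 'rV[R]_n) c :
  0 <= c -> (forall j, `|x 0 j| <= c) -> `|x| <= c.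
Proof.
move=> c0 H; rewrite [leLHS]/Num.Def.normr /= mx_normrE (bigmax_le _ c0) //.
by move=> -[i j] _; rewrite ord1.
Qed.

Lemma linear_norm_le n m (f : {linear 'rV[R]_n -> 'rV[R]_m}) (c : 'I_n -> R)
    (w : 'rV[R]_n) :
  (forall k, `|f (delta_mx 0 k)| <= c k) -> `|f w| <= (\sum_k c k) * `|w|.
Proof.
move=> H; rewrite [w in leLHS]row_sum_delta linear_sum mulr_suml.
apply: le_trans (ler_norm_sum _ _ _) _; apply: ler_sum => k _.
by rewrite linearZ normrZ mulrC ler_pM // coord_le_norm.
Qed.

Lemma linear_rV_bounded n m (f : {linear 'rV[R]_n -> 'rV[R]_m}) :
  exists2 C, 0 < C & forall w, `|f w| <= C * `|w|.
Proof.
exists (1 + \sum_k `|f (delta_mx 0 k)|) => [|w].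
  by rewrite ltr_wpDr // sumr_ge0.
rewrite mulrDl mul1r; apply: ler_wpDl => //.
exact: linear_norm_le.
Qed.

Lemma linear_rV_continuous n m (f : {linear 'rV[R]_n -> 'rV[R]_m}) : continuous f.
Proof.
have [C C0 bC] := linear_rV_bounded f.
apply: bounded_linear_continuous; apply/linear_boundedP.
exists C; split; first by rewrite num_real.
by move=> M CM x; rewrite (le_trans (bC x)) // ler_wpM2r // ltW.
Qed.

(** The norm is the maximum of the coordinates, so the scalar mean value theorem can be applied to
    each coordinate along the segment; the intermediate points differ, but the constant is the
    same. *)
Lemma mean_value_le n m (f : 'rV[R]_n -> 'rV[R]_m) (x y : 'rV[R]_n) (c : R) : 0 <= c ->
  (forall t : R, 0 <= t <= 1 -> differentiable f (y + t *: (x - y))) ->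
  (forall t : R, 0 <= t <= 1 -> `|'d f (y + t *: (x - y)) (x - y)| <= c) ->
  `|f x - f y| <= c.
Proof.
move=> c0 df nf; apply: norm_le_coord => // j.
pose l (t : R) := y + t *: (x - y).
have dl (t : R) : is_derive t 1 l (x - y).
  apply/is_derive_normP => e e0; near=> h.
  rewrite /l scalerDl addrA [X in X - _ - _]addrC addrK subrr normr0.
  by rewrite mulr_ge0 // ltW.
pose g (t : R) : R := f (l t) 0 j.
have dg (t : R) : 0 <= t <= 1 -> is_derive t 1 g ('d f (l t) (x - y) 0 j).
  move=> /df dft; have [dfl fl] := is_derive_diff_comp (dl t) dft.
  split; first by move/derivable_mxP : dfl => /(_ 0 j).
  by rewrite -fl (derive_mx dfl) mxE.
have [t t01] : exists2 t, t \in `[0, 1] &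
    g 1 - g 0 = 'd f (l t) (x - y) 0 j * (1 - 0).
  apply: MVT_segment ler01 _ _ => [t /itvP tE|].
    by apply: dg; rewrite !tE.
  apply: derivable_within_continuous => t /itvP tE.
  by have [] := dg t _; rewrite ?tE.
have -> : g 1 = f x 0 j by rewrite /g /l scale1r addrC subrK.
have -> : g 0 = f y 0 j by rewrite /g /l scale0r addr0.
rewrite subr0 mulr1 => E; rewrite !mxE E.
by apply: le_trans (coord_le_norm _ _) (nf _ _); move: t01; rewrite in_itv.
Unshelve. all: by end_near. Qed.

(** The partial derivatives are continuous, hence bounded by their values at [x0] plus 1 on some
    ball. This bounds the differential there, and the ball is convex, so the mean value inequality
    applies. *)
Lemma Ck_locally_lipschitz n m (U : set 'rV[R]_n) (f : 'rV[R]_n -> 'rV[R]_m)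
    (x0 : 'rV[R]_n) : open U -> U x0 -> Ck 2 U f ->
  exists r L, [/\ 0 < r, 0 <= L, forall x, `|x0 - x| < r -> U x &
    forall x y, `|x0 - x| < r -> `|x0 - y| < r -> `|f x - f y| <= L * `|x - y|].
Proof.
move=> oU Ux0 [df cdf].
have : \forall x \near x0, U x /\
    forall k, `|'d f x (delta_mx 0 k)| <= `|'d f x0 (delta_mx 0 k)| + 1.
  have H k : \forall x \near x0,
      `|'d f x (delta_mx 0 k)| <= `|'d f x0 (delta_mx 0 k)| + 1.
    have cx0 := differentiable_continuous ((cdf (delta_mx 0 k)).1 x0 Ux0).
    have := @cvgr_norm_le _ _ _ _ (nbhs_filter x0) _ _ cx0.
    by apply; rewrite ltrDl.
  have nU : nbhs x0 U by exact: open_nbhs_nbhs.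
  near=> x; split; first by near: x.
  by near: x; apply: filter_forall.
move=> /nbhs_normP[r /= r0 Hr].
exists r, (\sum_k (`|'d f x0 (delta_mx 0 k)| + 1)); split=> //.
- by apply: sumr_ge0 => k _; rewrite addr_ge0.
- by move=> x /Hr[].
move=> x y xr yr.
have lr (t : R) : 0 <= t <= 1 -> `|x0 - (y + t *: (x - y))| < r.
  move=> /andP[t0 t1].
  have -> : x0 - (y + t *: (x - y)) = t *: (x0 - x) + (1 - t) *: (x0 - y).
    by apply/rowP => j; rewrite !mxE; lra.
  apply: le_lt_trans (ler_normD _ _) _; rewrite !normrZ ger0_norm //.
  rewrite ger0_norm ?subr_ge0 //.
  (* The strict inequality is taken from the term with factor [t], so [t = 0] is treated apart. *)
  have [->|tn0] := eqVneq t 0; first by rewrite mul0r add0r subr0 mul1r.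
  have : t * `|x0 - x| < t * r by rewrite ltr_pM2l // lt_neqAle eq_sym tn0.
  have : (1 - t) * `|x0 - y| <= (1 - t) * r by rewrite ler_wpM2l ?subr_ge0 // ltW.
  lra.
apply: mean_value_le => [|t /lr /Hr[Ut _]|t /lr /Hr[_ nt]].
- by rewrite mulr_ge0 // sumr_ge0 // => k _; rewrite addr_ge0.
- exact: df.
- exact: linear_norm_le.
Unshelve. all: by end_near. Qed.

End Calculus.

(** * Nagumo's invariance theorem in coordinates *)

Section Nagumo.
Context {R : realType}.

Lemma nearest_point n (K : set 'rV[R]_n) (x : 'rV[R]_n) :
  compact K -> K !=set0 ->
  exists k, K k /\ forall k', K k' -> `|x - k| <= `|x - k'|.
Proof.
move=> cK K0.
have cd : {within K, continuous (fun k : 'rV[R]_n => `|x - k|)}.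
  apply: continuous_subspaceT => k.
  apply: (@continuous_comp _ _ _ (fun k : 'rV[R]_n => x - k)
    (fun k : 'rV[R]_n => `|k|)).
    by apply: continuousB => //; exact: cst_continuous.
  exact: norm_continuous.
have [k /set_mem Kk minK] := compact_EVT_min K0 cK cd.
by exists k; split=> // k' /mem_set /minK.
Qed.

(* Nagumo's theorem: the distance [d t] from [y t] to [S] satisfies
   [d (t + h) <= d t + |h| (L * d t + o(1))], seen by moving the nearest point
   of [S] along a curve in [S] tangent to [Y]. *)
Lemma nagumo_local n (S : set 'rV[R]_n) (Y : 'rV[R]_n -> 'rV[R]_n)
    (y : R -> 'rV[R]_n) (t0 r L : R) : 0 < r -> 0 <= L ->
  (forall x z, `|y t0 - x| < r -> `|y t0 - z| < r -> `|Y x - Y z| <= L * `|x - z|) ->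
  (forall x, `|y t0 - x| < r -> ~ S x -> nbhs x (~` S)) ->
  (forall x, `|y t0 - x| < r -> S x -> exists s : R -> 'rV[R]_n,
    [/\ s 0 = x, is_derive (0 : R) 1 s (Y x) & \forall h \near 0, S (s h)]) ->
  S (y t0) ->
  (\forall t \near t0, is_derive (t : R) 1 y (Y (y t))) ->
  \forall t \near t0, S (y t).
Proof.
move=> r0 L0 lipY cS tanS S0 dy.
(* Cutting [S] down to a closed ball makes it compact, so that nearest points exist; the radius
   [r / 2] stays inside the region where the hypotheses hold. *)
pose K := S `&` [set x | `|y t0 - x| <= r / 2].
have K0 : K (y t0) by split => //=; rewrite subrr normr0 divr_ge0 // ltW.
have cK : compact K.
  apply: bounded_closed_compact.
    exists (`|y t0| + r / 2); split; first by rewrite num_real.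
    move=> M M0 x [_ xr]; apply: le_trans (ltW M0).
    have -> : x = y t0 - (y t0 - x) by rewrite opprB addrC subrK.
    by apply: le_trans (ler_normB _ _) _; rewrite lerD2l.
  move=> x clx; have xr : `|y t0 - x| <= r / 2.
    rewrite leNgt; apply/negP => rx.
    have [|z [[_ /= zr]]] := clx (ball x (`|y t0 - x| - r / 2)).
      by apply: nbhsx_ballx; rewrite subr_gt0.
    rewrite -ball_normE /= => xz.
    have : `|y t0 - x| <= `|y t0 - z| + `|x - z|.
      by rewrite -[y t0 - x](subrKA z) (le_trans (ler_normD _ _)) // [`|x - z|]distrC.
    lra.
  split=> //; apply: contrapT => nSx.
  have xr' : `|y t0 - x| < r by lra.
  by have [z [[Sz _] nSz]] := clx _ (cS _ xr' nSx).
have [N Nmin] := choice (fun x => nearest_point x cK (ex_intro _ _ K0)).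
pose d (t : R) := `|y t - N (y t)|.
have dyk t k : K k -> d t <= `|y t - k| by move=> Kk; apply: (Nmin _).2.
have cy0 : {for t0, continuous y}.
  apply: differentiable_continuous; apply/derivable1_diffP.
  by have [] := nbhs_singleton dy.
(* If [y t] is within [r / 6] of [y t0], so is it of its nearest point, which is then within [r / 3]
   of [y t0]. Moving that point by less than [r / 6] keeps it within [r / 2], hence in [K]. *)
have : \forall t \near t0, is_derive (t : R) 1 y (Y (y t)) /\ `|y t0 - y t| < r / 6.
  apply: filterI => //; move/cvgrPdist_lt: cy0; apply; lra.
move=> /nbhs_normP[rho /= rho0 Hrho].
have {Hrho}[dyt yt] : (forall t : R, `|t - t0| < rho -> is_derive t 1 y (Y (y t))) /\
    (forall t : R, `|t - t0| < rho -> `|y t0 - y t| < r / 6).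
  by split=> t tr; have [] := Hrho t _; rewrite //= distrC.
have d0 (t : R) : `|t - t0| < rho -> d t <= 0.
  apply: (gronwall L0) => {t}.
  - move=> t /dyt[/derivable1_diffP/differentiable_continuous/cvgrPdist_le cyt _].
    apply/cvgrPdist_le => e e0; apply: filterS (cyt _ e0) => s yts.
    (* The distance to [K] is 1-Lipschitz, so [d] inherits the continuity of [y]. *)
    have dts a b : d a <= d b + `|y b - y a|.
      apply: le_trans (dyk a _ (Nmin (y b)).1) _.
      rewrite -[y a - _](subrKA (y b)) (le_trans (ler_normD _ _)) // addrC.
      by rewrite [`|y a - _|]distrC.
    apply: le_trans yts; rewrite ler_norml; have := dts t s; have := dts s t.
    rewrite [`|y s - _|]distrC; lra.
  - by apply: le_trans (dyk _ _ K0) _; rewrite subrr normr0.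
  move=> t tr e e0; set k := N (y t).
  have [[Sk kr2] _] := Nmin (y t); rewrite -/k /= in Sk kr2.
  have kr3 : `|y t0 - k| < r / 3.
    have : `|y t0 - k| <= `|y t0 - y t| + d t.
      by rewrite -[y t0 - k](subrKA (y t)) ler_normD.
    have := dyk t _ K0; rewrite distrC; have := yt _ tr; lra.
  have kr : `|y t0 - k| < r by lra.
  have [s [s0 ds Ss]] := tanS _ kr Sk.
  have cs : {for 0, continuous s}.
    by apply: differentiable_continuous; apply/derivable1_diffP; case: ds.
  have e2 : 0 < e / 2 by rewrite divr_gt0.
  have Hy := (is_derive_normP _ _ _).1 (dyt _ tr) _ e2.
  have Hs := (is_derive_normP _ _ _).1 ds _ e2.
  have Ks : \forall h \near 0, `|k - s h| < r / 6.
    by move/cvgrPdist_lt : cs; rewrite /= s0; apply; lra.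
  near=> h.
  have Ksh : K (s h).
    split; first by near: h.
    have : `|y t0 - s h| <= `|y t0 - k| + `|k - s h|.
      by rewrite -[y t0 - s h](subrKA k) ler_normD.
    have : `|k - s h| < r / 6 by near: h.
    by rewrite /=; lra.
  apply: le_trans (dyk _ _ Ksh) _.
  have H1 : `|y (t + h) - y t - h *: Y (y t)| <= e / 2 * `|h| by near: h.
  have H2 : `|s (0 + h) - s 0 - h *: Y k| <= e / 2 * `|h| by near: h.
  have H3 : `|Y (y t) - Y k| <= L * d t.
    by apply: lipY => //; have := yt _ tr; lra.
  rewrite add0r s0 in H2.
  (* The new difference is the old one, plus [h] times the difference of the fields, plus two
     first-order errors of at most [e / 2 * |h|] each. *)
  have -> : y (t + h) - s h = (y (t + h) - y t - h *: Y (y t)) +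
      (y t - k) + h *: (Y (y t) - Y k) - (s h - k - h *: Y k).
    by apply/rowP => i; rewrite !mxE; lra.
  apply: le_trans (ler_normB _ _) _.
  have := ler_normD (y (t + h) - y t - h *: Y (y t) + (y t - k)) (h *: (Y (y t) - Y k)).
  have := ler_normD (y (t + h) - y t - h *: Y (y t)) (y t - k).
  have : `|h *: (Y (y t) - Y k)| <= `|h| * (L * d t) by rewrite normrZ ler_wpM2l.
  rewrite -/(d t); lra.
near=> t.
have tr : `|t - t0| < rho.
  near: t; apply/nbhs_normP; exists rho => //= t; by rewrite distrC.
have : `|y t - N (y t)| <= 0 by exact: d0.
rewrite normr_le0 subr_eq0 => /eqP ->.
by case: (Nmin (y t)) => -[].
Unshelve. all: by end_near. Qed.

End Nagumo.

(** * Velocities of curves in manifolds *)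

Section Velocity.
Context {R : realType}.
Implicit Types M N P : manifoldType R.

Lemma chart_funK M (phi : chart R M (mdim M)) x :
  atlas M phi -> chart_img phi x -> chart_fun phi (chart_inv phi x) = x.
Proof. by move=> /atlas_chart[_ _ invK _ _] [p dp <-]; rewrite invK. Qed.

Lemma chart_invK M (phi : chart R M (mdim M)) p :
  atlas M phi -> chart_dom phi p -> chart_inv phi (chart_fun phi p) = p.
Proof. by move=> /atlas_chart[_ _ invK _ _]; exact: invK. Qed.

Lemma nbhs_chart_dom M (phi : chart R M (mdim M)) p :
  atlas M phi -> chart_dom phi p -> nbhs p (chart_dom phi).
Proof. by move=> /atlas_chart[? _ _ _ _] ?; exact: open_nbhs_nbhs. Qed.

Lemma chart_fun_continuous M (phi : chart R M (mdim M)) p :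
  atlas M phi -> chart_dom phi p -> {for p, continuous (chart_fun phi)}.
Proof. by move=> /atlas_chart[_ _ _ cf _]; exact: cf. Qed.

Lemma nbhs_chart_inv M (phi : chart R M (mdim M)) p (A : set M) :
  atlas M phi -> chart_dom phi p -> nbhs p A ->
  \forall x \near chart_fun phi p, chart_img phi x /\ A (chart_inv phi x).
Proof.
move=> aphi dp nA; have [_ oimg invK _ cinv] := atlas_chart _ aphi.
have ip : chart_img phi (chart_fun phi p) by exists p.
apply: filterI; first exact: open_nbhs_nbhs.
by apply: (cinv _ ip); rewrite invK.
Qed.

Lemma open_chart_image M (phi : chart R M (mdim M)) (W : set M) :
  atlas M phi -> open W -> open (chart_fun phi @` (chart_dom phi `&` W)).
Proof.
move=> aphi oW; rewrite openE => _ [p [dp Wp] <-].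
have nW : nbhs p (chart_dom phi `&` W).
  by apply: filterI; [exact: nbhs_chart_dom|exact: open_nbhs_nbhs].
apply: filterS (nbhs_chart_inv aphi dp nW) => x [ix dWx].
by exists (chart_inv phi x) => //; exact: chart_funK.
Qed.

(** Continuity is a separate condition because the chart maps have arbitrary values off their
    domains. Charted spaces are allowed so that the notion covers maps on a product. *)
Definition mdifferentiable (M N : chartedType R) (F : M -> N) (p : M) : Prop :=
  {for p, continuous F} /\
  differentiable (chart_fun (chart_at (F p)) \o F \o chart_inv (chart_at p))
    (chart_fun (chart_at p) p).

Definition has_velocity M (c : R -> M) (t : R) (u : 'rV[R]_(mdim M)) : Prop :=
  {for t, continuous c} /\
  is_derive t 1 (fun s => chart_fun (chart_at (c t)) (c s)) u.

Lemma has_velocity_inj M (c : R -> M) t u v :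
  has_velocity c t u -> has_velocity c t v -> u = v.
Proof. by move=> [_ [_ <-]] [_ [_ <-]]. Qed.

Lemma near_eq_has_velocity M (c d : R -> M) t u :
  (\near t, c t = d t) -> has_velocity c t u -> has_velocity d t u.
Proof.
move=> cd [cc dc]; have E := nbhs_singleton cd; split.
  change (d @ t --> d t); rewrite -E; apply: cvg_trans cc.
  exact: near_eq_cvg.
apply: near_eq_is_derive dc; rewrite -E.
by apply: filterS cd => s ->.
Qed.

Lemma is_derive_chart M (c : R -> M) t u (phi : chart R M (mdim M)) :
  has_velocity c t u -> atlas M phi -> chart_dom phi (c t) ->
  is_derive t 1 (fun s => chart_fun phi (c s)) (tangent_coord phi (c t) u).
Proof.
move=> [cc dc] aphi dphi; set psi := chart_at (c t) in dc.
have apsi : atlas M psi by exact: chart_at_atlas.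
have dpsi : chart_dom psi (c t) by exact: chart_at_dom.
have [df _] := atlas_compatible _ _ apsi aphi 1%N.
apply: near_eq_is_derive (is_derive_diff_comp dc (df _ _)) => //=.
  have nc : \forall s \near t, chart_dom psi (c s) := cc _ (nbhs_chart_dom apsi dpsi).
  apply: filterS nc => s ds /=.
  by rewrite chart_invK.
by exists (c t).
Qed.

Lemma has_velocity_push M N (F : M -> N) (c : R -> M) t u :
  has_velocity c t u -> mdifferentiable F (c t) ->
  has_velocity (F \o c) t (mdiff F (c t) u).
Proof.
move=> [cc dc] [cF dF]; split; first exact: continuous_comp.
apply: near_eq_is_derive (is_derive_diff_comp dc dF).
have nd := nbhs_chart_dom (chart_at_atlas (c t)) (chart_at_dom (c t)).
have nc : \forall s \near t, chart_dom (chart_at (c t)) (c s) := cc _ nd.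
apply: filterS nc => s ds /=.
by rewrite chart_invK //; exact: chart_at_atlas.
Qed.

Lemma velocity_exists M (p : M) (u : 'rV[R]_(mdim M)) :
  exists c : R -> M, c 0 = p /\ has_velocity c 0 u.
Proof.
set phi := chart_at p.
have aphi : atlas M phi by exact: chart_at_atlas.
have dphi : chart_dom phi p by exact: chart_at_dom.
pose l (s : R) := chart_fun phi p + s *: u.
have l0 : l 0 = chart_fun phi p by rewrite /l scale0r addr0.
have dl : is_derive (0 : R) 1 l u.
  apply/is_derive_normP => e e0; near=> h.
  by rewrite l0 /l add0r [X in X - _ - _]addrC addrK subrr normr0 mulr_ge0 // ltW.
have cl : {for 0, continuous l}.
  by apply: differentiable_continuous; apply/derivable1_diffP; case: dl.
have c0 : chart_inv phi (l 0) = p by rewrite l0 chart_invK.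
exists (chart_inv phi \o l); split => //; split.
  apply: continuous_comp => //; rewrite l0.
  have [_ _ _ _ cinv] := atlas_chart _ aphi.
  by apply: cinv; exists p.
rewrite /= c0 -/phi; apply: near_eq_is_derive dl.
have : \forall x \near chart_fun phi p, chart_img phi x.
  have [_ oimg _ _ _] := atlas_chart _ aphi.
  by apply: open_nbhs_nbhs; split => //; exists p.
rewrite -l0 => /cl nl.
have {}nl : \forall s \near 0, chart_img phi (l s) by [].
apply: filterS nl => s /= ls.
by rewrite chart_funK.
Unshelve. all: by end_near. Qed.

End Velocity.

(** * Differentials of smooth maps, and lifting curves through embeddings *)

Section Smooth.
Context {R : realType}.

Lemma differentiable_row_mx n1 n2 n (f : 'rV[R]_n -> 'rV[R]_n1)
    (g : 'rV[R]_n -> 'rV[R]_n2) x :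
  differentiable f x -> differentiable g x ->
  differentiable (fun x => row_mx (f x) (g x)) x.
Proof.
move=> df dg.
have -> : (fun x => row_mx (f x) (g x)) =
    (mulmxr (row_mx 1%:M 0) \o f : 'rV[R]_n -> 'rV[R]_(n1 + n2)) +
    (mulmxr (row_mx 0 1%:M) \o g : 'rV[R]_n -> 'rV[R]_(n1 + n2)).
  apply/funext => z; rewrite /= /(_ + _) /= !mul_mx_row !mulmx1 !mulmx0.
  by rewrite add_row_mx addr0 add0r.
apply: differentiableD; apply: differentiable_comp => //;
  exact/linear_differentiable/linear_rV_continuous.
Qed.

Lemma smooth_mdifferentiable_charted (M N : chartedType R) (F : M -> N) p :
  smooth F -> atlas M (chart_at p) -> chart_dom (chart_at p) p ->
  atlas N (chart_at (F p)) -> chart_dom (chart_at (F p)) (F p) ->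
  mdifferentiable F p.
Proof.
move=> [cF sF] aphi dphi apsi dpsi; split; first exact: cF.
by have [df _] := sF _ _ aphi apsi 1%N; apply: df; exists p.
Qed.

Implicit Types M N P : manifoldType R.

Lemma smooth_mdifferentiable M N (F : M -> N) p : smooth F -> mdifferentiable F p.
Proof.
move=> sF; apply: smooth_mdifferentiable_charted => //;
  by [exact: chart_at_atlas|exact: chart_at_dom].
Qed.

(** In product charts, freezing one variable is composition with a map that adjoins a constant block
    of coordinates. *)
Lemma smooth_mdifferentiable_partial M N P (F : M * N -> P) p q : smooth F ->
  mdifferentiable (fun x => F (x, q)) p /\ mdifferentiable (fun y => F (p, y)) q.
Proof.
move=> sF.
have ap : atlas M (chart_at p) by exact: chart_at_atlas.
have aq : atlas N (chart_at q) by exact: chart_at_atlas.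
have dp : chart_dom (chart_at p) p by exact: chart_at_dom.
have dq : chart_dom (chart_at q) q by exact: chart_at_dom.
have apq : atlas (M * N)%type (chart_at (p, q)).
  by exists (chart_at p) => //; exists (chart_at q).
have [cF dF] := smooth_mdifferentiable_charted sF apq (conj dp dq)
  (chart_at_atlas _) (chart_at_dom _).
split; split.
- apply: (@continuous_comp _ _ _ (fun x => (x, q)) F) => //.
  by apply: cvg_pair => //; exact: cvg_cst.
- have -> : chart_fun (chart_at (F (p, q))) \o (fun x => F (x, q)) \o
      chart_inv (chart_at p) =
    (chart_fun (chart_at (F (p, q))) \o F \o chart_inv (chart_at (p, q))) \o
      (fun x => row_mx x (chart_fun (chart_at q) q)).
    by apply/funext => x /=; rewrite row_mxKl row_mxKr chart_invK.
  apply: differentiable_comp => //; apply: differentiable_row_mx => //.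
- apply: (@continuous_comp _ _ _ (fun y => (p, y)) F) => //.
  by apply: cvg_pair => //; exact: cvg_cst.
- have -> : chart_fun (chart_at (F (p, q))) \o (fun y => F (p, y)) \o
      chart_inv (chart_at q) =
    (chart_fun (chart_at (F (p, q))) \o F \o chart_inv (chart_at (p, q))) \o
      (fun y => row_mx (chart_fun (chart_at p) p) y).
    by apply/funext => x /=; rewrite row_mxKl row_mxKr chart_invK.
  apply: differentiable_comp => //; apply: differentiable_row_mx => //.
Qed.

(** A curve with velocity [u] is pushed along both sides of the square; the two image curves
    coincide, and a velocity is unique. *)
Lemma mdiff_square M N N' P (F : M -> N) (F' : N -> P) (H : M -> N') (H' : N' -> P)
    p u : F' \o F = H' \o H ->
  mdifferentiable F p -> mdifferentiable F' (F p) ->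
  mdifferentiable H p -> mdifferentiable H' (H p) ->
  mdiff F' (F p) (mdiff F p u) = mdiff H' (H p) (mdiff H p u).
Proof.
move=> E; have [s [<- vs]] := velocity_exists p u => dF dF' dH dH'.
have v1 := has_velocity_push (has_velocity_push vs dF) dF'.
have v2 := has_velocity_push (has_velocity_push vs dH) dH'.
have Es : F' \o (F \o s) = H' \o (H \o s) 
  by apply/funext => r; exact: (congr1 (fun f => f (s r)) E).
by rewrite Es in v1; exact: has_velocity_inj v1 v2.
Qed.

(** An injective differential is bounded below, so the error of [y] is controlled by that of
    [f \o y] plus the error of linearizing [f]. The latter is small relative to the increment of [y]
    and is absorbed. *)
Lemma is_derive_lift n m (f : 'rV[R]_n -> 'rV[R]_m) (y : R -> 'rV[R]_n) t u :
  {for t, continuous y} -> differentiable f (y t) -> injective ('d f (y t)) ->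
  is_derive t 1 (f \o y) ('d f (y t) u) -> is_derive t 1 y u.
Proof.
move=> cy df injf dfy; set A := 'd f (y t) in injf dfy.
(* The pseudo-inverse of the matrix of [A] provides a bounded left inverse. *)
have [C C0 bC] : exists2 C, 0 < C & forall w, `|w| <= C * `|A w|.
  have Afree : row_free (lin1_mx A).
    apply: inj_row_free => w; rewrite mul_rV_lin1 => Aw0.
    by apply: injf; rewrite Aw0 linear0.
  have [C C0 bC] := linear_rV_bounded (mulmxr (pinvmx (lin1_mx A))).
  exists C => // w; have := bC (A w).
  by rewrite /= -mul_rV_lin1 -mulmxA mulmxVp // mulmx1.
apply/is_derive_normP => e e0.
(* The first entry makes [C * k <= 1 / 2], so that the term in [D] in [H6] moves to the left; the
   second makes what remains at most [e * |h|]. *)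
pose k := Num.min (1 / (2 * C)) (e / (2 * C * (`|u| + 1))).
have u1 : 0 < `|u| + 1 by rewrite ltr_wpDl.
have k0 : 0 < k by rewrite lt_min !divr_gt0 // ?mulr_gt0.
have Ck : C * k <= 1 / 2.
  have : k <= 1 / (2 * C) by rewrite ge_min lexx.
  by rewrite ler_pdivlMr ?mulr_gt0 // mulrCA; lra.
have Cku : 2 * (C * k * (`|u| + 1)) <= e.
  have : k <= e / (2 * C * (`|u| + 1)) by rewrite ge_min lexx orbT.
  by rewrite ler_pdivlMr ?mulr_gt0 //; lra.
have cz : (fun h => y (t + h) - y t) @ 0 --> (0 : 'rV[R]_n).
  rewrite -(subrr (y t)); apply: cvgB; last exact: cvg_cst.
  have ct : (fun h : R => t + h) @ 0 --> t + 0.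
    by apply: cvgD; [exact: cvg_cst|exact: cvg_id].
  by rewrite addr0 in ct; exact: (cvg_comp _ _ ct cy).
have dfk : \forall h \near 0,
    `|f (y (t + h) - y t + y t) - f (y t) - A (y (t + h) - y t)|
    <= k * `|y (t + h) - y t|.
  exact: cz (differentiable_norm df k0).
have dfyk := (is_derive_normP _ _ _).1 dfy _ k0.
near=> h.
have H1 : `|f (y (t + h) - y t + y t) - f (y t) - A (y (t + h) - y t)|
    <= k * `|y (t + h) - y t| by near: h.
have H2 : `|f (y (t + h)) - f (y t) - h *: A u| <= k * `|h| by near: h.
rewrite subrK in H1; set z := y (t + h) - y t in H1 *.
have H3 : `|A (z - h *: u)| <= k * `|z| + k * `|h|.
  have -> : A (z - h *: u) = (f (y (t + h)) - f (y t) - h *: A u) -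
      (f (y (t + h)) - f (y t) - A z).
    rewrite linearB linearZ.
    by apply/rowP => i; rewrite !mxE; lra.
  by apply: le_trans (ler_normB _ _) _; rewrite addrC lerD.
have H4 : `|z| <= `|z - h *: u| + `|h| * `|u|.
  by rewrite -normrZ -{1}[z](subrK (h *: u)) ler_normD.
have H5 := bC (z - h *: u).
set D := `|z - h *: u| in H4 H5 *.
have H6 : D <= C * k * (D + `|h| * `|u| + `|h|).
  apply: le_trans H5 _; rewrite -mulrA ler_pM2l // (le_trans H3) // -mulrDr.
  by rewrite ler_pM2l // lerD2r.
have H7 : C * k * D <= 1 / 2 * D by rewrite ler_wpM2r ?normr_ge0.
have H8 : 2 * (C * k * (`|u| + 1)) * `|h| <= e * `|h| by rewrite ler_wpM2r.
lra.
Unshelve. all: by end_near. Qed.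

Lemma has_velocity_lift M N (F : M -> N) (c : R -> M) t u :
  {for t, continuous c} -> mdifferentiable F (c t) -> injective (mdiff F (c t)) ->
  has_velocity (F \o c) t (mdiff F (c t) u) -> has_velocity c t u.
Proof.
move=> cc [_ dF] injF [_ dFc]; split => //.
have aphi : atlas M (chart_at (c t)) by exact: chart_at_atlas.
have dphi : chart_dom (chart_at (c t)) (c t) by exact: chart_at_dom.
apply: (is_derive_lift _ dF injF);
  first by apply: continuous_comp => //; exact: chart_fun_continuous.
have nc : \forall s \near t, chart_dom (chart_at (c t)) (c s) :=
  cc _ (nbhs_chart_dom aphi dphi).
apply: near_eq_is_derive dFc; apply: filterS nc => s ds /=.
by rewrite chart_invK.
Qed.

Lemma embedding_continuous M N (F : M -> N) (c : R -> M) t :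
  embedding F -> {for t, continuous (F \o c)} -> {for t, continuous c}.
Proof.
move=> [_ _ topF] cFc A; rewrite /= nbhsE => -[A' [oA' A't] A'A].
have [B oB A'B] := topF _ oA'.
have nB : nbhs (F (c t)) B.
  by apply: open_nbhs_nbhs; split => //; move: A't; rewrite A'B.
have nc : \forall s \near t, B (F (c s)) := cFc _ nB.
by apply: filterS nc => s Bs; apply: A'A; rewrite A'B.
Qed.

Lemma integral_curveP M (W : set M) X I c : integral_curve W X I c <->
  [/\ open I, is_interval I, I 0 &
      forall t, I t -> W (c t) /\ has_velocity c t (X (c t))].
Proof.
split=> -[oI iI I0 H]; split => // t It; first by have [] := H t It.
by have [? []] := H t It.
Qed.

Lemma integral_curve_push M N (F : M -> N) (W : set M) (W' : set N) X X' I c :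
  (forall p, W p -> [/\ mdifferentiable F p, W' (F p) & X' (F p) = mdiff F p (X p)]) ->
  integral_curve W X I c -> integral_curve W' X' I (F \o c).
Proof.
move=> HF /integral_curveP[oI iI I0 H]; apply/integral_curveP; split => // t It.
have [Wt ct] := H t It; have [dF W't E] := HF _ Wt.
by split => //=; rewrite E; exact: has_velocity_push.
Qed.

End Smooth.

(** * Nagumo's theorem on a manifold *)

Section InvariantSubset.
Context {R : realType}.

(* It suffices to show that the set of times at which the curve is in [S] is
   open and closed in [I]; openness is Nagumo's theorem in a chart. *)
Lemma nagumo (M : manifoldType R) (W S : set M) (Y : vector_field M)
    (I : set R) (c : R -> M) :
  open W -> smooth_vector_field_on W Y ->
  (forall p, W p -> ~ S p -> nbhs p (~` S)) ->
  (forall p, W p -> S p -> exists s : R -> M,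
    [/\ s 0 = p, has_velocity s 0 (Y p) & \forall h \near 0, S (s h)]) ->
  integral_curve W Y I c -> S (c 0) -> forall t, I t -> S (c t).
Proof.
move=> oW sY cS tanS /integral_curveP[oI iI I0 Hc] S0.
have stays t : I t -> S (c t) -> \forall s \near t, S (c s).
  move=> It St; have [Wt vt] := Hc t It.
  set phi := chart_at (c t).
  have aphi : atlas M phi by exact: chart_at_atlas.
  have dphi : chart_dom phi (c t) by exact: chart_at_dom.
  pose y s := chart_fun phi (c s).
  have oU := open_chart_image aphi oW.
  have Ut : (chart_fun phi @` (chart_dom phi `&` W)) (y t) by exists (c t).
  have [r [L [r0 L0 rU lipY]]] := Ck_locally_lipschitz oU Ut (sY _ aphi 2%N).
  have nd : \forall s \near t, chart_dom phi (c s) := vt.1 _ (nbhs_chart_dom aphi dphi).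
  have St' : S (chart_inv phi (y t)) by rewrite chart_invK.
  (* Near [t] the curve stays in the chart domain, where [S] may be replaced by its preimage under
     [chart_inv phi]. *)
  suff Sy : \forall s \near t, S (chart_inv phi (y s)).
    near=> s.
    have ds : chart_dom phi (c s) by near: s.
    by rewrite -(chart_invK aphi ds); near: s.
  apply: (nagumo_local (S := S \o chart_inv phi) r0 L0 lipY) => //.
  - move=> _ /rU[p [dp Wp] <-] /= nSp; rewrite chart_invK // in nSp.
    by apply: filterS (nbhs_chart_inv aphi dp (cS _ Wp nSp)) => x [].
  - move=> _ /rU[p [dp Wp] <-] /=; rewrite chart_invK // => Sp.
    have [s [s0 vs Ss]] := tanS _ Wp Sp.
    have ds0 : chart_dom phi (s 0) by rewrite s0.
    exists (chart_fun phi \o s); split; first by rewrite /= s0.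
      by rewrite -s0; apply: is_derive_chart => //; rewrite s0.
    have nds : \forall h \near 0, chart_dom phi (s h) := vs.1 _ (nbhs_chart_dom aphi ds0).
    near=> h; have dsh : chart_dom phi (s h) by near: h.
    by rewrite /= chart_invK //; near: h.
  - have nI : nbhs t I by exact: open_nbhs_nbhs.
    near=> s; have ds : chart_dom phi (c s) by near: s.
    have [|_ vs] := Hc s; first by near: s.
    by rewrite /y chart_invK //; exact: is_derive_chart.
pose J := I `&` [set t | S (c t)].
suff -> : I = J by move=> t [].
apply/esym/((connected_intervalP I).2 iI) => //; first by exists 0.
  exists J; last by rewrite /J setIA setIid.
  rewrite openE => t [It St].
  by apply: filterI; [exact: open_nbhs_nbhs|exact: stays].
exists (closure J); first exact: closed_closure.
apply/seteqP; split=> [t Jt|t [It clJ]];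
  first by split; [case: Jt|exact: subset_closure].
(* Closedness in [I]: if [c t] were outside [S], nearby times would be as well, as [S] is closed in
   [W], so [t] would not be in the closure of [J]. *)
split=> //=; apply: contrapT => nSt; have [Wt vt] := Hc t It.
have nc : \forall s \near t, ~ S (c s) := vt.1 _ (cS _ Wt nSt).
by have [s [[_ Ss] nSs]] := clJ _ nc.
Unshelve. all: by end_near. Qed.

End InvariantSubset.

(** * Slices and the topology of the tube *)

Section Slices.
Context {R : realType}.
Variables (G : lieGroupType R) (M : manifoldType R) (a : G -> M -> M).
Hypothesis ha : smooth_action a.
Variables (m : M) (K : lieGroupType R) (i : K -> G) (hK : is_stabilizer a m i).
Variables (V : manifoldType R) (b : K -> V -> V) (j : V -> M).
Hypothesis hj : is_slice a m i b j.

Let a1 p : a 1%g p = p. Proof. by case: ha. Qed.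
Let aM g h p : a (g * h)%g p = a g (a h p). Proof. by case: ha. Qed.
Let hb : smooth_action b. Proof. by case: hj. Qed.
Let b1 v : b 1%g v = v. Proof. by case: hb. Qed.
Let bM k l v : b (k * l)%g v = b k (b l v). Proof. by case: hb. Qed.
Let jb k v : j (b k v) = a (i k) (j v). Proof. by case: hj => _ []. Qed.
Let emb_j : embedding j. Proof. by case: hj => _ []. Qed.
Let j_inj : injective j. Proof. by case: emb_j. Qed.
Let open_tube : open (tube a j). Proof. by case: hj. Qed.

Lemma action_mdifferentiable g p : mdifferentiable (a g) p.
Proof. by case: ha => _ _ sa; exact: (smooth_mdifferentiable_partial g p sa).2. Qed.

Lemma orbit_mdifferentiable g p : mdifferentiable (a^~ p) g.
Proof. by case: ha => _ _ sa; exact: (smooth_mdifferentiable_partial g p sa).1. Qed.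

Lemma slice_mdifferentiable v : mdifferentiable j v.
Proof. by case: emb_j => -[sj _] _ _; exact: smooth_mdifferentiable. Qed.

Lemma stabilizerM k l : i (k * l)%g = (i k * i l)%g.
Proof. by case: hK. Qed.

Lemma stabilizer1 : i 1%g = 1%g.
Proof. by apply: (mulgI (i 1%g)); rewrite -stabilizerM !mulg1. Qed.

Lemma stabilizerP g : a g m = m <-> exists k, g = i k.
Proof.
case: hK => _ _ /seteqP[H1 H2]; split=> [/H2[k _ <-]|[k ->]]; first by exists k.
exact/H1/imageT.
Qed.

Lemma tube_act g p : tube a j p -> tube a j (a g p).
Proof. by move=> [h [v ->]]; exists (g * h)%g, v. Qed.

Lemma tube_slice v : tube a j (j v).
Proof. by exists 1%g, v. Qed.

(** The diffeomorphism [Phi] is injective on the associated bundle, so the two pairs lie in one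
    orbit of the stabilizer. *)
Lemma tube_inj g h v w : a g (j v) = a h (j w) ->
  exists k, h = (g * (i k)^-1)%g /\ w = b k v.
Proof.
case: hj => _ _ _ _ [Q [q [Phi [[_ qeq _ _] PhiE _ [_ _ _ [H PhiK _]]]]]].
rewrite -!PhiE => /(can_inj PhiK)/qeq[k [-> ->]]; by exists k.
Qed.

(* The tube carries the quotient topology of [G * V]. *)
Lemma nbhs_tube (A : set (G * V)%type) g v :
  open A -> (forall h w k, A ((h * (i k)^-1)%g, b k w) -> A (h, w)) ->
  A (g, v) -> nbhs (a g (j v)) [set a x.1 (j x.2) | x in A].
Proof.
move=> oA Ainv Agv; case: hj => _ _ _ _ [Q [q [Phi [[_ qeq qopen _] PhiE _]]]].
move=> [_ _ _ [H PhiK [cH _]]].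
have qA x : (q @` A) (q x) -> A x.
  move=> [y Ay /esym/qeq[k yE]]; case: x yE => h w yE.
  by apply: (Ainv h w k); rewrite -yE.
have oqA : open (q @` A).
  apply/qopen; suff -> : q @^-1` (q @` A) = A by [].
  by apply/seteqP; split=> x; [exact: qA|exists x].
have tgv : tube a j (a g (j v)) by exists g, v.
have nH : \forall p \near a g (j v), (q @` A) (H p).
  apply: (cH _ tgv); rewrite -PhiE PhiK.
  by apply: open_nbhs_nbhs; split=> //; exists (g, v).
have nt : \forall p \near a g (j v), tube a j p by exact: open_nbhs_nbhs.
near=> p; have [h [w pE]] : tube a j p by near: p.
have : (q @` A) (H p) by near: p.
by rewrite pE -PhiE PhiK => /qA Ahw; exists (h, w) => //=; rewrite PhiE.
Unshelve. all: by end_near. Qed.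

(** A point [a g (j v)] lies in the slice only if [g] fixes [m]. The pairs whose group component
    moves [m] form an open set, since points of [M] are closed, and this set is saturated, so its
    image is a neighborhood of [p] that misses the slice. *)
Lemma slice_closed p : tube a j p -> ~ range j p -> nbhs p (~` range j).
Proof.
move=> [g [v ->]] njp.
pose A := [set x : G * V | a x.1 m <> m].
have oA : open A.
  have cA : continuous (fun x : G * V => a x.1 m).
    move=> x; apply: (@continuous_comp _ _ _ fst (a^~ m)); first exact: cvg_fst.
    by case: (orbit_mdifferentiable x.1 m).
  have om : open (~` [set m]).
    by apply/closed_openC/accessible_closed_set1/hausdorff_accessible/manifold_hausdorff.
  by move/continuousP : cA => /(_ _ om).
have Ainv h w k : A ((h * (i k)^-1)%g, b k w) -> A (h, w).
  move=> /= nA hm; apply: nA.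
  have km : a (i k) m = m by apply/stabilizerP; exists k.
  have kVm : a (i k)^-1%g m = m by rewrite -{1}km -aM mulVg a1.
  by rewrite aM kVm.
have Agv : A (g, v).
  by move=> /stabilizerP[k gk]; apply: njp; exists (b k v) => //; rewrite jb -gk.
apply: filterS (nbhs_tube oA Ainv Agv) => _ [[h w] Ahw <-] [w' _] /= E.
rewrite -[j w']a1 in E; have [k [hE _]] := tube_inj E.
apply: Ahw; apply/stabilizerP; exists k^-1%g.
rewrite hE mul1g; apply: (mulgI (i k)).
by rewrite mulgV -stabilizerM mulgV stabilizer1.
Qed.

(** * The equivariant extension: integral curves, relative equilibria and stability *)

Variables (X : vector_field V) (Y : vector_field M).
Hypothesis hY : is_equivariant_extension a j X Y.

Lemma extension_slice v : Y (j v) = mdiff j v (X v).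
Proof.
have a1j : a 1%g \o j = j by apply/funext => w; exact: a1.
by have := hY.2 1%g v; rewrite a1j a1.
Qed.

Lemma extension_act g p : tube a j p -> Y (a g p) = mdiff (a g) p (Y p).
Proof. by case: hY => -[_ Yeq] _; exact: Yeq. Qed.

Lemma integral_curve_act g I c : integral_curve (tube a j) Y I c ->
  integral_curve (tube a j) Y I (a g \o c).
Proof.
apply: integral_curve_push => p tp; split.
- exact: action_mdifferentiable.
- exact: tube_act.
- exact: extension_act.
Qed.

Lemma integral_curve_slice I c : integral_curve setT X I c ->
  integral_curve (tube a j) Y I (j \o c).
Proof.
apply: integral_curve_push => v _; split.
- exact: slice_mdifferentiable.
- exact: tube_slice.
- exact: extension_slice.
Qed.

Lemma integral_curve_stays_in_slice I c : integral_curve (tube a j) Y I c ->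
  range j (c 0) -> forall t, I t -> range j (c t).
Proof.
move=> icc c0; apply: (nagumo (W := tube a j) (Y := Y)) icc c0 => //.
- by case: hY => -[].
- exact: slice_closed.
(* Tangency to the slice: the image under [j] of a curve with velocity [X v] stays in the slice and
   has velocity [Y (j v)]. *)
move=> _ _ [v _ <-]; have [s [s0 vs]] := velocity_exists v (X v).
exists (j \o s); split; first by rewrite /= s0.
  by have := has_velocity_push vs (slice_mdifferentiable _); rewrite s0 -extension_slice.
by near=> h; exists (s h).
Unshelve. all: by end_near. Qed.

Lemma maximal_integral_curve_slice I c g d :
  maximal_integral_curve (tube a j) Y I c -> c 0 = a g (j d) ->
  exists e, [/\ maximal_integral_curve setT X I e, e 0 = d &
    forall t, I t -> c t = a g (j (e t))].
Proof.
move=> [icc maxc] c0.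
have aK p : a g (a g^-1%g p) = p by rewrite -aM mulgV a1.
have icc' := integral_curve_act g^-1%g icc.
have c'0 : (a g^-1%g \o c) 0 = j d by rewrite /= c0 -aM mulVg a1.
have inj t : I t -> range j ((a g^-1%g \o c) t).
  by apply: integral_curve_stays_in_slice => //; rewrite c'0; exists d.
have [e eE] : {e : R -> V & forall t, I t -> j (e t) = (a g^-1%g \o c) t}.
  apply: (@choice _ _ (fun t v => I t -> j v = (a g^-1%g \o c) t)) => t.
  (* Off [I] the condition on [e] is vacuous, and [d] serves only as a witness. *)
  by have [/inj[v _ <-]|nI] := pselect (I t); [exists v|exists d].
have cE t : I t -> c t = a g (j (e t)) by move=> It; rewrite eE //= aK.
have /integral_curveP[oI iI I0 Hc'] := icc'.
have ice : integral_curve setT X I e.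
  apply/integral_curveP; split => // t It; split => //.
  have nI : \forall s \near t, (a g^-1%g \o c) s = (j \o e) s.
    have nI : nbhs t I by exact: open_nbhs_nbhs.
    by apply: filterS nI => s Is /=; rewrite eE.
  have [_ vt] := Hc' t It.
  have {}vt := near_eq_has_velocity nI vt.
  rewrite -(eE _ It) extension_slice in vt.
  have ce : {for t, continuous e} by apply: embedding_continuous emb_j vt.1.
  apply: has_velocity_lift (slice_mdifferentiable _) _ vt => //.
  by case: emb_j => -[_ injj] _ _; exact: injj.
exists e; split => //; last by apply: j_inj; rewrite eE.
(* An extension [f] of [e] is carried by [a g \o j] to an extension of [c], so maximality of [c]
   applies. *)
split=> // J f icf IJ fe; apply: (maxc _ (a g \o (j \o f))) => //.
  exact/integral_curve_act/integral_curve_slice.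
by move=> t It; rewrite /= fe // cE.
Qed.

(** By equivariance of [j], the orbit map of [v] followed by [j] is [i] followed by the orbit map of
    [j v]. Differentiating at the identity sends the tangent space of the small orbit into that of
    the large one. *)
Lemma relative_equilibrium_slice v : relative_equilibrium b setT X v ->
  relative_equilibrium a (tube a j) Y (j v).
Proof.
move=> [_ [w _ wE]]; split; first exact: tube_slice.
have E : j \o b^~ v = a^~ (j v) \o i by apply/funext => k /=; rewrite jb.
have db : mdifferentiable (b^~ v) 1%g.
  by case: hb => _ _ sb; exact: (smooth_mdifferentiable_partial 1%g v sb).1.
have di : mdifferentiable i 1%g.
  by case: hK => _ [[si _] _ _] _; exact: smooth_mdifferentiable.
have := mdiff_square w E db (slice_mdifferentiable _) di (orbit_mdifferentiable _ (j v)).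
rewrite wE b1 stabilizer1 => Ew.
exists (mdiff i 1%g w); first by [].
by rewrite -Ew extension_slice.
Qed.

Lemma stable_slice v : stable b setT X v -> stable a (tube a j) Y (j v).
Proof.
move=> sv U Ut nU invU.
have nU' : nbhs v (j @^-1` U) by case: (slice_mdifferentiable v) => cj _; exact: cj.
have [|O [OU nO HO]] := sv (j @^-1` U) (subsetT _) nU'.
  by move=> k w /= Uw; rewrite jb; exact: invU.
(* Passing to all stabilizer translates of the interior of [O] makes [A] open and saturated, as
   [nbhs_tube] requires; its image is still the [G]-saturation of the image of that interior under
   [j]. *)
pose A := [set x : G * V | exists k, (O^°) (b k x.2)].
exists [set a x.1 (j x.2) | x in A]; split.
- move=> _ [[g w] [k /interior_subset/OU Ow] <-] /=; apply: (invU g).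
  rewrite /= jb in Ow; have := invU (i k)^-1%g _ Ow.
  by rewrite -aM mulVg a1.
- rewrite -(a1 (j v)); apply: nbhs_tube.
  + have -> : A = \bigcup_k ((fun x : G * V => b k x.2) @^-1` O^°).
      by apply/seteqP; split=> x [k]; exists k.
    apply: bigcup_open => k _.
    have ck : continuous (fun x : G * V => b k x.2).
      move=> x; apply: (@continuous_comp _ _ _ snd (b k)); first exact: cvg_snd.
      by case: hb => _ _ sb; case: (smooth_mdifferentiable_partial k x.2 sb) => _ [].
    by move/continuousP : ck; apply; exact: open_interior.
  + by move=> h w k [l /= Ol]; exists (l * k)%g; rewrite /= bM.
  + by exists 1%g; rewrite /= b1; exact: nO.
move=> I c mc [[g w] [k Ok] /= c0] t It.
(* The factor [i k^-1] is absorbed into the group element, so that the curve starts at a translate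
   of [j (b k w)] with [b k w] in [O]. *)
have wE : w = b k^-1%g (b k w) by rewrite -bM mulVg b1.
rewrite wE jb -aM in c0.
have [e [me e0 cE]] := maximal_integral_curve_slice mc (esym c0).
rewrite cE //; apply: invU; apply: (HO I e me) => //.
by rewrite e0; exact: interior_subset.
Qed.

End Slices.

Theorem proposition3p10 (R : realType)
  (G : lieGroupType R) (M : manifoldType R) (a : G -> M -> M)
  (ha : proper_action a) (m : M)
  (Gm : lieGroupType R) (i : Gm -> G) (hGm : is_stabilizer a m i)
  (V : manifoldType R) (b : Gm -> V -> V) (j : V -> M)
  (hj : is_slice a m i b j)
  (X : vector_field V) (hX : equivariant_vector_field b setT X)
  (EX : vector_field M) (hEX : is_equivariant_extension a j X EX)
  (v : V)
  (hv : relative_equilibrium b setT X v) (hs : stable b setT X v) :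
  relative_equilibrium a (tube a j) EX (j v) /\
  stable a (tube a j) EX (j v).
Proof.
case: ha => sa _; split.
  exact: (relative_equilibrium_slice sa hGm hj hEX hv).
exact: (stable_slice sa hGm hj hEX hs).
Qed.
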